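(* Let $\mathcal{A}$ be a (not necessarily associative) algebra over a field $\mathbb{F}$ with $\dim_{\mathbb{F}}(\mathcal{A})>1$. If $\mathcal{S}$ is a proper subalgebra of $\mathcal{A}$ such that $\mathcal{A}=\mathcal{S}+\mathrm{ann}(\mathcal{A})$, then $\mathcal{A}$ is decomposable.
   Context: $\mathrm{ann}(\mathcal{A})=\{x\in\mathcal{A}: x\mathcal{A}=\mathcal{A}x=0\}$. An algebra $\mathcal{A}$ is decomposable if there are nonzero ideals $\mathcal{I}$ and $\mathcal{J}$ with $\mathcal{A}=\mathcal{I}\oplus\mathcal{J}$; otherwise it is indecomposable. Algebras need not be associative, commutative or unital. *)

(* Defs.v *)
From mathcomp Require Export all_boot all_order all_algebra.
From mathcomp Require Export sesquilinear.
From mathcomp Require Export boolp classical_sets functions cardinality.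

Set Implicit Arguments.
Unset Strict Implicit.
Unset Printing Implicit Defensive.

Import GRing.Theory.
Local Open Scope classical_set_scope.
Local Open Scope card_scope.
Local Open Scope ring_scope.

Section Dimension.
Context {F : fieldType} {V : lmodType F}.
Implicit Types (B : set V) (n : nat).

Definition lin_indep B : Prop :=
  forall (s : seq V) (c : V -> F), uniq s -> [set` s] `<=` B ->
    \sum_(x <- s) c x *: x = 0 -> forall x, x \in s -> c x = 0.

Definition lin_span B : set V :=
  [set v | exists (s : seq V) (c : V -> F),
     [set` s] `<=` B /\ v = \sum_(x <- s) c x *: x].

Definition is_basis B : Prop := lin_indep B /\ lin_span B = [set: V].

End Dimension.

(* [dim V > n]: the cardinal of a basis of [V] is not at most [n]; an infinite
   basis is allowed. *)
Definition dim_gt {F : fieldType} (V : lmodType F) (n : nat) : Prop :=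
  exists B : set V, is_basis B /\ ~ (B #<= `I_n).

(* The library's algebra structures are associative, hence the bare bilinear
   product [mul]. *)
Section NonassociativeAlgebra.
Context {F : fieldType} {A : lmodType F}.
Variable mul : {bilinear A -> A -> A}.
Implicit Types S I J : set A.

Definition ann : set A :=
  [set x | forall y, mul x y = 0 /\ mul y x = 0].

Definition sum_set S I : set A := [set x + y | x in S & y in I].

Definition is_subalgebra S : Prop :=
  submod_closed [in S] /\ (forall x y, S x -> S y -> S (mul x y)).

Definition is_ideal I : Prop :=
  submod_closed [in I] /\
  (forall a x, I x -> I (mul a x) /\ I (mul x a)).

Definition is_direct_sum I J : Prop :=
  sum_set I J = [set: A] /\ I `&` J = [set 0].

Definition decomposable : Prop :=
  exists I J : set A,
    [/\ is_ideal I, is_ideal J, I <> [set 0], J <> [set 0]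
      & is_direct_sum I J].

End NonassociativeAlgebra.

(* Main.v *)
(** Some [x] in the annihilator lies outside [S].  By Zorn's lemma there is a
    subspace [H] containing [S] with [A = H (+) F x].  Since
    [A A = S S <= S <= H], the subspace [H] is an ideal, and so is the line
    [F x] because [x] annihilates [A].  Finally [H <> 0], as [dim A > 1]. *)

Require Import Defs.

Set Implicit Arguments.
Unset Strict Implicit.
Unset Printing Implicit Defensive.

Import GRing.Theory.
Local Open Scope classical_set_scope.
Local Open Scope ring_scope.

Section Subspaces.
Context {F : fieldType} {V : lmodType F}.
Implicit Types (S H : set V) (x : V).

Lemma submod_closed_setP S :
  GRing.submod_closed [in S] <->
  S 0 /\ (forall a u v, S u -> S v -> S (a *: u + v)).
Proof.
split=> -[S0 Slin]; split.
- exact: set_mem S0.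
- by move=> a u v Su Sv; apply: set_mem; apply: Slin; apply: mem_set.
- exact: mem_set.
- move=> a u v Su Sv; apply: mem_set.
  by apply: Slin; [exact: set_mem Su | exact: set_mem Sv].
Qed.

Definition line x : set V := [set c *: x | c in [set: F]].

Lemma line_submod_closed x : GRing.submod_closed [in line x].
Proof.
apply/submod_closed_setP; split; first by exists 0 => //; rewrite scale0r.
move=> a _ _ [c _ <-] [d _ <-]; exists (a * c + d) => //.
by rewrite scalerDl scalerA.
Qed.

Lemma sum_line_submod_closed S x :
  GRing.submod_closed [in S] -> GRing.submod_closed [in sum_set S (line x)].
Proof.
move=> /submod_closed_setP[S0 Slin].
have /submod_closed_setP[L0 Llin] := line_submod_closed x.
apply/submod_closed_setP; split.
  by exists 0 => //; exists 0 => //; rewrite addr0.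
move=> a _ _ [u Su [v Lv <-]] [w Sw [z Lz <-]].
exists (a *: u + w); first exact: Slin.
exists (a *: v + z); first exact: Llin.
by rewrite scalerDr addrACA.
Qed.

(** Zorn's lemma for the subspaces that contain [S] and miss [x], a class closed under unions of
    nonempty chains. *)
Lemma maximal_submod_avoiding S x :
  GRing.submod_closed [in S] -> ~ S x ->
  exists H, [/\ GRing.submod_closed [in H], S `<=` H, ~ H x &
    forall K, GRing.submod_closed [in K] -> H `<=` K -> ~ K x -> K `<=` H].
Proof.
move=> Ssub Sx; have /submod_closed_setP[S0 Slin] := Ssub.
(* The union with [S] makes the empty set admissible, which is needed for the
   empty chain in Zorn's lemma. *)
pose P X := GRing.submod_closed [in X `|` S] /\ ~ (X `|` S) x.
have [C CP Ctot|X [[Xsub Xx] Xmax]] := @Zorn_bigcup _ P.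
  split; last first.
    by move=> [[X CX Xx]|//]; have [_] := CP _ CX; apply; left.
  apply/submod_closed_setP; split; first by right.
  have Clin X a u v : C X -> (X `|` S) u -> (X `|` S) v ->
      (\bigcup_(Y in C) Y `|` S) (a *: u + v).
    move=> CX Xu Xv; have [/submod_closed_setP[_ Xlin] _] := CP _ CX.
    by have [Xw|Sw] := Xlin a u v Xu Xv; [left; exists X | right].
  (* Two vectors from members of the chain lie in the larger member, and a vector of [S] lies in
     every [X]|[S]. *)
  move=> a u v [[X CX Xu]|Su] [[Y CY Yv]|Sv].
  - have [XY|YX] := Ctot X Y CX CY.
      by apply: (Clin Y) => //; left => //; apply: XY.
    by apply: (Clin X) => //; left => //; apply: YX.
  - by apply: (Clin X) => //; [left | right].
  - by apply: (Clin Y) => //; [right | left].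
  - by right; apply: Slin.
exists (X `|` S); split=> // K Ksub XSK Kx y Ky; apply: contrapT => XSy.
have KS : K `|` S = K by apply/setUidPl => z Sz; apply: XSK; right.
(* [K] is admissible since it absorbs [S], and strictly larger than [X] since [y] lies outside
   [X]. *)
apply: (Xmax K); last by rewrite /P KS.
split; first by move=> z Xz; apply: XSK; left.
by move=> KX; apply: XSy; left; apply: KX.
Qed.

(** A subspace [H] maximal among those avoiding [x] is a complement: for [y] outside [H], maximality
    puts [x] in [H + F y], and the relation can be solved for [y]. A nonzero multiple of [x] in [H]
    would put [x] itself in [H]. *)
Lemma submod_complement_line S x :
  GRing.submod_closed [in S] -> ~ S x ->
  exists H, [/\ GRing.submod_closed [in H], S `<=` H
    & is_direct_sum H (line x)].
Proof.
move=> Ssub Sx; have [H [Hsub SH Hx Hmax]] := maximal_submod_avoiding Ssub Sx.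
have /submod_closed_setP[H0 Hlin] := Hsub.
have HZ a u : H u -> H (a *: u) by move=> Hu; rewrite -[_ *: _]addr0; apply: Hlin.
exists H; split=> //; split; apply/seteqP; split=> // y.
- move=> _; have [Hy|Hy] := pselect (H y).
    by exists y => //; exists 0; rewrite ?addr0 //; exists 0; rewrite ?scale0r.
  have : sum_set H (line y) x.
    apply: contrapT => Kx; apply: Hy.
    apply: (Hmax _ (sum_line_submod_closed y Hsub) _ Kx).
      move=> z Hz; exists z => //; exists 0; rewrite ?addr0 //.
      by exists 0; rewrite ?scale0r.
    by exists 0 => //; exists y; rewrite ?add0r //; exists 1; rewrite ?scale1r.
  move=> [h Hh [_ [c _ <-] hcx]].
  have c0 : c != 0.
    by apply: contra_notN Hx => /eqP c0; rewrite -hcx c0 scale0r addr0.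
  (* Solve [h + c *: y = x] for [y]. *)
  exists (- c^-1 *: h); first exact: HZ.
  exists (c^-1 *: x); first by exists c^-1.
  by rewrite -hcx scalerDr scalerA mulVf // scale1r addrA scaleNr addNr add0r.
- move=> [Hy [c _ cxy]] /=; move: Hy; rewrite -cxy.
  have [->|c0 Hcx] := eqVneq c 0; first by rewrite scale0r.
  by case: Hx; rewrite -[x]scale1r -(mulVf c0) -scalerA; apply: HZ.
- move=> ->; split=> //; exists 0 => //; exact: scale0r.
Qed.

(** Any two vectors on one line are linearly dependent, so a basis inside a line has at most one
    element. *)
Lemma dim_gt1_line_neqT x : dim_gt V 1 -> line x <> [set: V].
Proof.
move=> [B [[Bfree _] Bgt1]] lineT; apply: Bgt1.
have line_all v : line x v by rewrite lineT.
have Bneq0 b : B b -> b <> 0.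
  move=> Bb b0; have /(_ _ _ b) := @Bfree [:: b] (fun=> 1) isT.
  have sB : [set` [:: b]] `<=` B by move=> z /=; rewrite inE => /eqP ->.
  rewrite big_seq1 b0 scaler0 mem_head => /(_ _ erefl isT) one0.
  by have /eqP := one0 ltac:(by rewrite -b0); rewrite oner_eq0.
have Beq b1 b2 : B b1 -> B b2 -> b1 = b2.
  move=> Bb1 Bb2; apply: contrapT => /eqP b12.
  have [c1 _ E1] := line_all b1; have [c2 _ E2] := line_all b2.
  have sB : [set` [:: b1; b2]] `<=` B.
    by move=> z /=; rewrite !inE => /orP[] /eqP ->.
  have u12 : uniq [:: b1; b2] by rewrite /= inE b12.
  (* As [b1 = c1 *: x] and [b2 = c2 *: x], these coefficients give a vanishing combination;
     independence then forces [c2 = 0], hence [b2 = 0]. *)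
  have := @Bfree _ (fun b => if b == b1 then c2 else - c1) u12 sB.
  rewrite big_cons big_seq1 eqxx [b2 == b1]eq_sym (negPf b12).
  have -> : c2 *: b1 + - c1 *: b2 = 0.
    by rewrite -E1 -E2 !scalerA mulNr mulrC scaleNr subrr.
  move=> /(_ erefl b1); rewrite mem_head eqxx => /(_ isT) c20.
  by apply: (Bneq0 b2) => //; rewrite -E2 c20 scale0r.
have [[b Bb]|/set0P/negP/negPn/eqP ->] := pselect (B !=set0); last first.
  exact: card_ge0.
have -> : B = [set b].
  by apply/seteqP; split=> [z Bz|z ->//]; apply: Beq.
by have /card_eqPle[] := @card_set1 _ b.
Qed.

End Subspaces.

Section Ideals.
Context {F : fieldType} {A : lmodType F}.
Variable mul : {bilinear A -> A -> A}.
Implicit Types S H : set A.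

Lemma line_ann_ideal x : ann mul x -> is_ideal mul (line x).
Proof.
move=> annx; split; first exact: line_submod_closed.
move=> a _ [c _ <-]; have [xa ax] := annx a.
by split; exists 0 => //; rewrite scale0r ?linearZr ?linearZl /= ?xa ?ax scaler0.
Qed.

(** The annihilator parts drop out: [(s + y)(t + z) = s t]. Hence every subspace containing [S] is
    an ideal. *)
Lemma mul_sum_ann S u v :
  is_subalgebra mul S -> sum_set S (ann mul) = [set: A] -> S (mul u v).
Proof.
move=> [_ Smul] sumT.
have : [set: A] u by []; rewrite -sumT => -[s Ss [y annu <-]].
have : [set: A] v by []; rewrite -sumT => -[t St [z annv <-]].
rewrite linearDl linearDr /= (annu _).1 (annv _).2 !addr0.
exact: Smul.
Qed.

End Ideals.

Theorem lemma2p4 (F : fieldType) (A : lmodType F)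
    (mul : {bilinear A -> A -> A}) (S : set A) :
  dim_gt A 1 ->
  is_subalgebra mul S ->
  S <> [set: A] ->
  sum_set S (ann mul) = [set: A] ->
  decomposable mul.
Proof.
move=> dimA Salg SneqT sumT; have [Ssub _] := Salg.
have /submod_closed_setP[S0 Slin] := Ssub.
(* If the annihilator were inside [S], then [S + ann] would be [S], which is proper. *)
have [x annx Sx] : exists2 x, ann mul x & ~ S x.
  apply: contrapT => nox; apply: SneqT; apply/seteqP; split=> // y.
  rewrite -sumT => -[s Ss [z annz <-]].
  rewrite -[s]scale1r; apply: Slin => //.
  by apply: contrapT => Sz; apply: nox; exists z.
have [H [Hsub SH HxT]] := submod_complement_line Ssub Sx.
exists H, (line x); split=> //.
- by split=> // a y _; split; apply: SH; apply: mul_sum_ann.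
- exact: line_ann_ideal.
(* With [H] zero, the line alone would be the whole algebra. *)
- move=> H0; apply: (dim_gt1_line_neqT (x := x) dimA).
  have [<- _] := HxT; rewrite H0; apply/seteqP; split=> z.
    by move=> Lz; exists 0 => //; exists z => //; rewrite add0r.
  by move=> [_ -> [y Ly <-]]; rewrite add0r.
(* A zero line means [x = 0], which lies in [S]. *)
- move=> L0; apply: Sx; have : line x x by exists 1 => //; rewrite scale1r.
  by rewrite L0 => ->.
Qed.
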